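(* Let $X$ be a Polish space and $d$ a pseudo-metric on $X$. If the set $\{(u,v)\in X^2: d(u,v)<\delta\}$ is $\mathbf{\Pi}^1_1$ for each $\delta>0$, then either $(X,d)$ is separable or there are $\delta>0$ and a perfect set $C\subseteq X$ such that $d(u,v)\ge\delta$ for all distinct $u,v\in C$.
   Context: A Polish space is a separable, completely metrizable topological space. The pseudo-metric $d$ is not assumed to be related to the topology of $X$. $\mathbf{\Pi}^1_1$ denotes the class of coanalytic sets, here in the Polish space $X^2$ (with the product of the Polish topology of $X$). Separability of $(X,d)$ refers to the pseudo-metric topology of $d$: there is a countable $S\subseteq X$ such that for every $u\in X$ and every $\varepsilon>0$ there is $s\in S$ with $d(u,s)<\varepsilon$. A perfect set is a nonempty closed set without isolated points, with respect to the Polish topology of $X$. *)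

(* Defs.v *)
From mathcomp Require Import all_boot all_order all_algebra.
From mathcomp Require Import all_classical all_reals topology.

Set Implicit Arguments.
Unset Strict Implicit.
Unset Printing Implicit Defensive.

Import Order.TTheory GRing.Theory Num.Theory.

Local Open Scope classical_set_scope.
Local Open Scope ring_scope.

Section pseudometrics.
Context {R : realType} {T : Type}.
Implicit Types d : T -> T -> R.

Definition is_pseudometric d : Prop :=
  [/\ forall x y, 0 <= d x y,
      forall x, d x x = 0,
      forall x y, d x y = d y x
    & forall x y z, d x z <= d x y + d y z].

Definition is_metric d : Prop :=
  is_pseudometric d /\ forall x y, d x y = 0 -> x = y.

Definition cauchy_sequence d (u : nat -> T) : Prop :=
  forall e : R, 0 < e ->
    exists N : nat, forall m n : nat,
      (N <= m)%N -> (N <= n)%N -> d (u m) (u n) < e.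

Definition separable_pseudometric d : Prop :=
  exists2 S : set T, countable S
    & forall (u : T) (e : R), 0 < e -> exists2 s, S s & d u s < e.

End pseudometrics.

Definition metric_induces_topology (R : realType) (X : topologicalType)
    (d : X -> X -> R) : Prop :=
  forall (x : X) (A : set X),
    nbhs x A <-> exists2 e : R, 0 < e & [set y | d x y < e] `<=` A.

Definition completely_metrizable (R : realType) (X : topologicalType) : Prop :=
  exists d : X -> X -> R,
    [/\ is_metric d,
        metric_induces_topology d
      & forall u : nat -> X, cauchy_sequence d u ->
          exists l : X, u @ \oo --> l].

Definition separable_space (X : topologicalType) : Prop :=
  exists2 S : set X, countable S & dense S.

Definition polish_space (R : realType) (X : topologicalType) : Prop :=
  separable_space X /\ completely_metrizable R X.

(* [nat] carries its discrete topology, so [{ptws nat -> nat}] is the Baire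
   space; the empty set is not an image of it and is added separately. *)
Definition analytic_set (X : topologicalType) (A : set X) : Prop :=
  A = set0 \/
  exists2 f : {ptws nat -> nat} -> X, continuous f & range f = A.

Definition coanalytic_set (X : topologicalType) (A : set X) : Prop :=
  analytic_set (~` A).

(* Main.v *)
(* For e > 0 let G_e be the analytic graph {d >= e}. If for every e > 0 the space
   is a countable union of G_e-independent sets, i.e. of sets on which d < e, then
   (X, d) is separable. Otherwise fix a bad e = delta. As in Miller's classical
   proof of the G_0-dichotomy, approximations that survive the removal of any
   countably colorable set extend one step at a time; they yield a continuous p on
   2^N mapping the edges of G_0 to edges of G_delta. Colorings may be arbitrary
   rather than Borel, so neither separation nor a transfinite derivative is needed.
   Let F be the pullback of {d >= delta/2} along p. By the triangle inequality, for
   every G_0-edge (x, y) and every z, (z, x) or (z, y) is in F, whereas a generic z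
   and a generic G_0-edge (x, y) would avoid F if F were meager in a box; hence F is
   nonmeager in every box of 2^N x 2^N. Since F is the projection of a closed set, a
   fusion along cylinders whose projections are everywhere nonmeager gives a Cantor
   set whose distinct points are pairwise F-related. *)
Require Import Defs.
From mathcomp Require Import all_boot all_order all_algebra.
From mathcomp Require Import all_classical all_reals topology.

Set Implicit Arguments.
Unset Strict Implicit.
Unset Printing Implicit Defensive.

Import Order.TTheory GRing.Theory Num.Theory.

Local Open Scope classical_set_scope.

(** * Sequences and their finite prefixes *)

Lemma stepwise_choice (T : Type) (P : nat -> T -> Prop)
    (Q : nat -> T -> T -> Prop) (t0 : T) :
  P 0 t0 -> (forall n t, P n t -> exists t', P n.+1 t' /\ Q n t t') ->
  exists f : nat -> T,
    f 0 = t0 /\ forall n, P n (f n) /\ Q n (f n) (f n.+1).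
Proof.
move=> P0 PS.
have /choice[g gP] (nt : nat * T) :
    exists t', P nt.1 nt.2 -> P nt.1.+1 t' /\ Q nt.1 nt.2 t'.
  case: (pselect (P nt.1 nt.2)) => [/PS[t' ?]|nP]; first by exists t'.
  by exists nt.2 => /nP.
pose f := fix f n := if n is m.+1 then g (m, f m) else t0.
have Pf n : P n (f n) by elim: n => // n /(gP (n, f n))[].
by exists f; split=> // n; split=> //; have [] := gP (n, f n) (Pf n).
Qed.

Definition follows {T : Type} (u : seq T) (x : nat -> T) :=
  mkseq x (size u) = u.

Section follows.
Context {T : eqType}.
Implicit Types (u v : seq T) (x : nat -> T).

Lemma follows_nth u x d i : follows u x -> i < size u -> x i = nth d u i.
Proof. by move=> <- lti; rewrite nth_mkseq // -(size_mkseq x (size u)). Qed.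

Lemma nth_follows u x d :
  (forall i, i < size u -> x i = nth d u i) -> follows u x.
Proof.
move=> xu; apply: (@eq_from_nth _ d) => [|i]; rewrite size_mkseq // => lti.
by rewrite nth_mkseq // xu.
Qed.

Lemma follows_agree u x y i :
  follows u x -> follows u y -> i < size u -> x i = y i.
Proof.
move=> ux uy lti.
by rewrite (follows_nth (x i) ux) // (follows_nth (x i) uy).
Qed.

Lemma follows_cat u v x :
  follows (u ++ v) x <-> follows u x /\ follows v (fun i => x (size u + i)).
Proof.
rewrite /follows size_cat /mkseq iotaD map_cat /= add0n.
have -> n : iota (size u) n = map (addn (size u)) (iota 0 n).
  by rewrite -iotaDl addn0.
rewrite -map_comp.
split=> [/eqP|[-> ->] //].
by rewrite eqseq_cat ?size_map ?size_iota // => /andP[/eqP-> /eqP->].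
Qed.

Lemma follows_prefix u v x : prefix u v -> follows v x -> follows u x.
Proof. by move=> /prefixP[w ->] /follows_cat[]. Qed.

Lemma prefix_mkseq x m n : m <= n -> prefix (mkseq x m) (mkseq x n).
Proof.
by move=> /subnKC <-; rewrite /mkseq iotaD map_cat prefix_prefix.
Qed.

Lemma extend_or_incompatible u v :
  (exists w, prefix u (v ++ w)) \/ forall x, follows v x -> ~ follows u x.
Proof.
have [/prefixP[w ->]|nuv] := boolP (prefix v u).
  by left; exists w; rewrite prefix_refl.
have [vu|nvu] := boolP (prefix u v).
  by left; exists [::]; rewrite cats0.
right=> x vx ux; case: (leqP (size u) (size v)) => [|/ltnW].
  by move/(prefix_mkseq x); rewrite ux vx (negbTE nvu).
by move/(prefix_mkseq x); rewrite ux vx (negbTE nuv).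
Qed.

Lemma prefix_chain (u : nat -> seq T) m n :
  (forall n, prefix (u n) (u n.+1)) -> m <= n -> prefix (u m) (u n).
Proof.
move=> uS /subnKC <-; elim: (n - m) => [|k IHk].
  by rewrite addn0 prefix_refl.
by rewrite addnS; exact: prefix_trans IHk (uS _).
Qed.

Lemma follows_chain (u : nat -> seq T) (d : T) :
  (forall n, prefix (u n) (u n.+1)) -> exists x, forall n, follows (u n) x.
Proof.
move=> uS.
have /choice[x xP] i :
    exists a, forall n, i < size (u n) -> nth d (u n) i = a.
  case: (pselect (exists n, i < size (u n))) => [[n ltn]|none]; last first.
    by exists d => n ltn; case: none; exists n.
  exists (nth d (u n) i) => m ltm.
  have pre a b : a <= b -> i < size (u a) -> nth d (u a) i = nth d (u b) i.
    move=> /(prefix_chain uS)/prefixP[w ->] lta.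
    by rewrite nth_cat lta.
  by case: (leqP m n) => [le|/ltnW le]; [exact: pre | exact/esym/pre].
by exists x => n; apply: (@nth_follows _ _ d) => i /xP.
Qed.

End follows.

(** The newest bit comes first, so that in a binary tree a child of a node is reached by [cons] and
    its parent by [behead]. *)
Fixpoint rev_prefix (x : nat -> bool) n :=
  if n is m.+1 then x m :: rev_prefix x m else [::].

Lemma size_rev_prefix x n : size (rev_prefix x n) = n.
Proof. by elim: n => //= n ->. Qed.

Lemma eq_rev_prefix x y n :
  (forall i, i < n -> x i = y i) -> rev_prefix x n = rev_prefix y n.
Proof.
elim: n => //= n IHn xy; rewrite xy // IHn // => i lti.
by rewrite xy // ltnS ltnW.
Qed.

Lemma rev_prefixD x m n :
  rev_prefix x (m + n) = rev_prefix (fun i => x (m + i)) n ++ rev_prefix x m.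
Proof. by elim: n => [|n IHn]; rewrite ?addn0 // addnS /= IHn. Qed.

Fixpoint words n : seq (seq bool) :=
  if n is m.+1 then
    [::] :: [seq false :: u | u <- words m] ++ [seq true :: u | u <- words m]
  else [:: [::]].

Lemma mem_words u n : size u <= n -> u \in words n.
Proof.
elim: n u => [[]|n IHn [|b u]] //= /IHn un.
rewrite inE mem_cat /=; case: b; rewrite ?map_f ?orbT //.
Qed.

(* The [n]-th binary string of the dense sequence defining the graph G_0 is
   formed by the [n] lowest binary digits of [n]. *)
Definition digits n : nat -> bool := fun i => odd (n %/ 2 ^ i).

(** This is the density of the strings defining G_0: every finite word begins some [k]-th string.
    The bound [n < k] is strict so that doubling preserves it along the induction. *)
Lemma digits_dense (x : nat -> bool) n :
  exists2 k, n < k & forall i, i < n -> digits k i = x i.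
Proof.
elim: n x => [|n IHn] x; first by exists 1.
have [k ltnk kx] := IHn (fun i => x i.+1).
exists (x 0 + k.*2).
  apply: leq_trans (leq_addl _ _); apply: (@leq_trans n.+1.*2).
    by rewrite doubleS !ltnS -addnn leq_addr.
  by rewrite leq_double.
case=> [_|i lti]; rewrite /digits.
  by rewrite expn0 divn1 oddD odd_double addbF; case: (x 0).
rewrite expnS divnMA divn2 halfD odd_double andbF add0n doubleK.
by rewrite -[RHS]kx //; case: (x 0).
Qed.

(** * A continuous homomorphism from the graph G_0 *)

Section coloring.
Context {T : Type} (G : T -> T -> Prop).
Implicit Types A B : set T.

Definition independent A := forall a b, A a -> A b -> ~ G a b.

Definition countably_colorable A :=
  exists2 B : nat -> set T, (forall i, independent (B i))
    & A `<=` \bigcup_i B i.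

Lemma independent_colorable A : independent A -> countably_colorable A.
Proof. by move=> iA; exists (fun=> A) => // a Aa; exists 0. Qed.

Lemma colorable_bigcup (I : countType) (A : I -> set T) :
  (forall i, countably_colorable (A i)) ->
  countably_colorable (\bigcup_i A i).
Proof.
move=> cA; have /choice[B BP] i : exists B : nat -> set T,
    (forall j, independent (B j)) /\ A i `<=` \bigcup_j B j.
  by have [B ? ?] := cA i; exists B.
exists (fun n => if unpickle n is Some (i, j) then B i j else set0).
  by move=> n; case: unpickle => [[i j]|]; [have [] := BP i | move=> ? ? []].
move=> a [i _ /(proj2 (BP i))[j _ Ba]].
by exists (pickle (i, j)) => //=; rewrite pickleK.
Qed.

Lemma colorable_setU A B : countably_colorable A -> countably_colorable B ->
  countably_colorable (A `|` B).
Proof.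
move=> cA cB; have -> : A `|` B = \bigcup_(b : bool) (if b then A else B).
  apply/seteqP; split=> a.
    by case=> ?; [exists true | exists false].
  by case=> [[]] _ ?; [left | right].
by apply: colorable_bigcup; case.
Qed.

End coloring.

Definition agree {T : Type} n (a b : nat -> T) := forall i, i < n -> a i = b i.

(** Closedness in a product of sequence spaces over discrete sets, expressed by finite agreement. *)
Definition closed3 {T1 T2 T3 : Type}
    (K : (nat -> T1) -> (nat -> T2) -> (nat -> T3) -> Prop) :=
  forall a b c, (forall n, exists a' b' c',
    [/\ K a' b' c', agree n a' a, agree n b' b & agree n c' c]) -> K a b c.

Section homomorphism.
Context (K : (nat -> nat) -> (nat -> nat) -> (nat -> nat) -> Prop).
Let G a b := exists c, K a b c.

(* A finite configuration of level [n] lives on the binary tree of height [n]: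
   words of length [n] carry the images of the vertices of the [n]-th
   approximation of G_0 (the last bit of the vertex is the first of the word),
   shorter words carry a witness for one of the edges. *)
Definition config := seq bool -> nat -> nat.
Implicit Types (c : config) (u : seq bool).

Definition subconfig c b : config := fun u => c (b :: u).

Definition join c0 c1 w : config :=
  fun u => if u is b :: v then (if b then c1 else c0) v else w.

Fixpoint valid n c : Prop :=
  if n is m.+1 then
    [/\ forall b, valid m (subconfig c b)
      & K (c (false :: rev_prefix (digits m) m))
          (c (true :: rev_prefix (digits m) m)) (c [::])]
  else True.

Definition agree_config n c c' :=
  forall u, size u <= n -> agree n (c u) (c' u).

Definition avoids n (M : set (nat -> nat)) c :=
  forall u, size u = n -> ~ M (c u).

(** Only the finite part of [c] seen by [agree_config n] is judged: removing a countably colorable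
    set must leave a valid realization of it. *)
Definition good n c := forall M, countably_colorable G M ->
  exists c', [/\ valid n c', agree_config n c c' & avoids n M c'].

Definition code n c : seq nat :=
  [seq c p.1 p.2 | p <- [seq (u, i) | u <- words n, i <- iota 0 n]].

Lemma code_agree n c c' : code n c = code n c' -> agree_config n c c'.
Proof.
move=> /eq_in_map cc' u su i lti; apply: (cc' (u, i)).
by apply/allpairsP; exists (u, i); rewrite mem_words // mem_iota.
Qed.

(** If no extension were good, the code of each one would be blocked by a colorable set, and there
    are only countably many codes. Off the union [N] of these sets, the values at the distinguished
    vertex form an independent set, since an edge would join two configurations into an unblocked
    valid one. Removing both sets contradicts [good n c]. *)
Lemma good_extend n c : good n c ->
  exists c', good n.+1 c' /\ forall b, agree_config n c (subconfig c' b).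
Proof.
move=> gc; apply: contrapT => noext.
have /choice[M MP] (s : seq nat) : exists M, countably_colorable G M /\
    forall c', code n.+1 c' = s -> ~ good n.+1 c' ->
    forall c'', code n.+1 c'' = s -> valid n.+1 c'' -> ~ avoids n.+1 M c''.
  case: (pselect (exists2 c', code n.+1 c' = s & ~ good n.+1 c')); last first.
    move=> nex; exists set0; split; first by apply: independent_colorable.
    by move=> c' cs ngc'; elim: nex; exists c'.
  case=> c0 <- /existsNP[M /not_implyP[cM nM]]; exists M; split=> //.
  move=> _ _ _ c'' cc'' vc'' ac''; apply: nM; exists c''; split=> //.
  exact/code_agree/esym.
set N := \bigcup_s M s.
have cN : countably_colorable G N.
  by apply: colorable_bigcup => s; have [] := MP s.
pose A := [set a | exists c', [/\ valid n c', agree_config n c c',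
  avoids n N c' & a = c' (rev_prefix (digits n) n)]].
have iA : independent G A.
  move=> _ _ [c0 [v0 a0 N0 ->]] [c1 [v1 a1 N1 ->]] [w Kw].
  pose c' := join c0 c1 w.
  have vc' : valid n.+1 c' by split=> //; case.
  have ngc' : ~ good n.+1 c'.
    by move=> ?; apply: noext; exists c'; split=> // -[].
  apply: (proj2 (MP (code n.+1 c')) c' erefl ngc' c') => // u.
  by case: u => // -[] u [su] Mu; [apply: (N1 u su) | apply: (N0 u su)];
    exists (code n.+1 c').
have [c' [vc' ac' NAc']] := gc _ (colorable_setU cN (independent_colorable iA)).
apply: (NAc' (rev_prefix (digits n) n)); first exact: size_rev_prefix.
right; exists c'; split=> // u su Nu; apply: (NAc' u) => //; by left.
Qed.

Lemma valid_cat n c u : valid (size u + n) c -> valid n (fun v => c (u ++ v)).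
Proof. by elim: u c => //= b u IHu c [/(_ b)/IHu]. Qed.

Definition G0_edge k (x y : nat -> bool) :=
  [/\ agree k x (digits k), agree k y (digits k), x k = false, y k = true
    & forall i, k < i -> x i = y i].

Lemma G0_homomorphism :
  closed3 K -> ~ countably_colorable G setT ->
  exists p : (nat -> bool) -> nat -> nat,
    (forall x y i, (forall j, j <= i -> x j = y j) -> p x i = p y i) /\
    forall k x y, G0_edge k x y -> G (p x) (p y).
Proof.
move=> clK ncT.
have g0 : good 0 (fun _ _ => 0).
  move=> M cM; have [a nMa] : exists a, ~ M a.
    apply: contrapT => nex; apply: ncT; suff <- : M = setT by [].
    apply/seteqP; split=> // a _; apply: contrapT => nMa.
    by case: nex; exists a.
  by exists (fun=> a); split=> // u _.
have [C [_ CP]] := stepwise_choice g0 good_extend.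
(* [C n] itself need not be valid; goodness against the empty set supplies a valid configuration
   with the same finite part. *)
have Cvalid n : exists2 c, valid n c & agree_config n (C n) c.
  have cc0 : countably_colorable G set0 by apply: independent_colorable.
  by have [/(_ _ cc0)[c [vc ac _]] _] := CP n; exists c.
(* With [k = 0] this is the image of a vertex; with [k.+1] and a tail of [x] it is the witness of an
   edge created at level [k.+1]. The value at [i] is stable from level [k + i.+1] on. *)
pose lim k x i := C (k + i.+1) (rev_prefix x i.+1) i.
have limE k x m i : i < m -> C (k + m) (rev_prefix x m) i = lim k x i.
  move=> /subnKC <-; elim: (m - i.+1) => [|j IHj]; first by rewrite addn0.
  rewrite -IHj addnS /= addnS.
  apply/esym/(proj2 (CP _) (x (i.+1 + j))).
    by rewrite /= size_rev_prefix leq_addl.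
  by rewrite (leq_trans _ (leq_addl _ _)) // leq_addr.
exists (lim 0); split=> [x y i xy|k x y [xk yk xF yT xy]].
  by rewrite /lim (@eq_rev_prefix x y).
exists (lim k.+1 (fun i => x (k.+1 + i))); apply: clK => m.
have [c vc ac] := Cvalid (k.+1 + m).
set r := rev_prefix (fun i => x (k.+1 + i)) m.
have /valid_cat[_] : valid (size r + k.+1) c by rewrite size_rev_prefix addnC.
set s := rev_prefix (digits k) k; rewrite cats0 => Kc.
exists (c (r ++ false :: s)), (c (r ++ true :: s)), (c r).
have rx z : agree k z (digits k) ->
    (forall i, k < i -> x i = z i) ->
    r ++ z k :: s = rev_prefix z (k.+1 + m).
  move=> zk xz; rewrite rev_prefixD /= (eq_rev_prefix zk); congr (_ ++ _).
  by apply: eq_rev_prefix => i _; rewrite xz // addSn ltnS leq_addr.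
split=> //.
- rewrite -xF rx // => i lti.
  rewrite -ac ?size_rev_prefix // ?(leq_trans lti) ?leq_addl //.
  by rewrite -(@limE 0 x (k.+1 + m)) // (leq_trans lti) ?leq_addl.
- rewrite -yT rx // => i lti.
  rewrite -ac ?size_rev_prefix // ?(leq_trans lti) ?leq_addl //.
  by rewrite -(@limE 0 y (k.+1 + m)) // (leq_trans lti) ?leq_addl.
- move=> i lti; rewrite -ac ?size_rev_prefix ?leq_addl //.
    by rewrite limE.
  by rewrite (leq_trans lti) ?leq_addl.
Qed.

End homomorphism.

(** * Category in the square of the Cantor space *)

Section category.
Implicit Types (E : (nat -> bool) -> (nat -> bool) -> Prop)
  (D : seq bool -> seq bool -> Prop) (u v : seq bool) (x y : nat -> bool).

Definition dense_cond D := forall u v, exists s t, D (u ++ s) (v ++ t).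

Definition meets D x y := exists u v, [/\ D u v, follows u x & follows v y].

(** The points meeting a dense [D] form a dense open set, so this is meagerness in the square of the
    Cantor space, coded by boxes of words. *)
Definition meager2 E := exists2 D : nat -> seq bool -> seq bool -> Prop,
  forall n, dense_cond (D n)
  & forall x y, (forall n, meets (D n) x y) -> ~ E x y.

Lemma meager2_sub E E' :
  (forall x y, E x y -> E' x y) -> meager2 E' -> meager2 E.
Proof. by move=> EE' [D dD DE]; exists D => // x y /DE nE /EE'. Qed.

Lemma meager2_bigcup (I : countType) (E : I -> _ -> _ -> Prop) :
  (forall i, meager2 (E i)) -> meager2 (fun x y => exists i, E i x y).
Proof.
move=> mE; have /choice[D DP] i :
    exists D : nat -> seq bool -> seq bool -> Prop,
    (forall n, dense_cond (D n)) /\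
    forall x y, (forall n, meets (D n) x y) -> ~ E i x y.
  by have [D ? ?] := mE i; exists D.
exists (fun m => if unpickle m is Some (i, n) then D i n else fun _ _ => True).
  move=> m; case: unpickle => [[i n]|]; first by have [] := DP i.
  by move=> u v; exists [::], [::].
move=> x y mxy [i]; apply: (proj2 (DP i)) => n.
by have := mxy (pickle (i, n)); rewrite pickleK.
Qed.

Lemma meager2_setU E E' :
  meager2 E -> meager2 E' -> meager2 (fun x y => E x y \/ E' x y).
Proof.
move=> mE mE'; apply: (@meager2_sub _
    (fun x y => exists b : bool, (if b then E else E') x y)).
  move=> x y [?|?]; first by exists true.
  by exists false.
by apply: (@meager2_bigcup _ (fun b : bool => if b then E else E')) => -[].
Qed.

Lemma dense_meager2 D : dense_cond D -> meager2 (fun x y => ~ meets D x y).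
Proof. by move=> dD; exists (fun=> D) => [_|x y /(_ 0) ?] //; apply. Qed.

Lemma meager2_set0 E : (forall x y, ~ E x y) -> meager2 E.
Proof.
move=> E0; exists (fun _ _ _ => True) => [_ u v|x y _]; last exact: E0.
by exists [::], [::].
Qed.

(** A box version of Banach's category theorem: the boxes that miss the box of [u] and [v] or carry
    only a meager part of [E] are dense, and there are countably many boxes. *)
Lemma meager2_local E u v :
  (forall s t, exists s' t', meager2 (fun x y =>
     [/\ follows (u ++ s ++ s') x, follows (v ++ t ++ t') y & E x y])) ->
  meager2 (fun x y => [/\ follows u x, follows v y & E x y]).
Proof.
move=> loc.
pose mbox u1 v1 := meager2 (fun x y =>
  [/\ follows u1 x, follows v1 y & E x y]).
pose D u1 v1 := [\/ forall x, follows u1 x -> ~ follows u x,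
  forall y, follows v1 y -> ~ follows v y | mbox u1 v1].
have dD : dense_cond D.
  move=> u1 v1.
  have [[s /prefixP[s' us]]|inc] := extend_or_incompatible u u1; last first.
    by exists [::], [::]; rewrite !cats0; apply: Or31.
  have [[t /prefixP[t' vt]]|inc] := extend_or_incompatible v v1; last first.
    by exists [::], [::]; rewrite !cats0; apply: Or32.
  have [s'' [t'' m]] := loc s' t'.
  exists (s ++ s''), (t ++ t''); apply: Or33.
  by rewrite !catA us vt -!catA.
have mU : meager2 (fun x y => exists uv : seq bool * seq bool,
    [/\ mbox uv.1 uv.2, follows uv.1 x, follows uv.2 y & E x y]).
  apply: meager2_bigcup => -[u1 v1] /=.
  case: (pselect (mbox u1 v1)) => [|nm].
    by apply: meager2_sub => x y [].
  by apply: meager2_set0 => x y [].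
apply: meager2_sub (meager2_setU (dense_meager2 dD) mU) => x y [ux vy Exy].
case: (pselect (meets D x y)) => [[u1 [v1 [Duv ux1 vy1]]]|]; last by left.
right; exists (u1, v1); split=> //=.
by case: Duv => // [/(_ x ux1)|/(_ y vy1)].
Qed.

(* Baire category, applied to a generic [z] and a generic G_0-edge [(x, y)] at
   the same time. *)
Lemma G0_nonmeager2 E :
  (forall k x y z, G0_edge k x y -> E z x \/ E z y) ->
  forall u v, ~ meager2 (fun x y => [/\ follows u x, follows v y & E x y]).
Proof.
move=> edgeE u v [D dD DE].
(* The [k]-th string extends [v], which puts both ends of the edge into the cylinder of [v]. *)
have [k ltvk kv] := digits_dense (nth false v) (size v).
pose w b (t : seq bool) := mkseq (digits k) k ++ b :: t.
(* First components grow to [z], second ones to the common tail of [x] and [y]; one step makes both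
   [(z, x)] and [(z, y)] meet [D n]. *)
pose Q n (at_ at' : seq bool * seq bool) :=
  [/\ prefix at_.1 at'.1, prefix at_.2 at'.2,
      exists a1 t1, [/\ D n a1 (w false t1), prefix a1 at'.1 & prefix t1 at'.2]
    & exists a1 t1, [/\ D n a1 (w true t1), prefix a1 at'.1 & prefix t1 at'.2]].
have QS n st : True -> exists st', True /\ Q n st st'.
  case: st => a t _.
  have [s0 [t0 D0]] := dD n a (w false t).
  have [s1 [t1 D1]] := dD n (a ++ s0) (w true (t ++ t0)).
  exists (a ++ s0 ++ s1, t ++ t0 ++ t1); split=> //; split=> /=.
  - exact: prefix_prefix.
  - exact: prefix_prefix.
  - exists (a ++ s0), (t ++ t0); rewrite !catA !prefix_prefix; split=> //.
    by move: D0; rewrite /w -catA.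
  - exists (a ++ s0 ++ s1), (t ++ t0 ++ t1); rewrite !prefix_refl; split=> //.
    by move: D1; rewrite /w -!catA /= -!catA.
have [f [f0 fP]] :=
  @stepwise_choice _ (fun _ _ => True) Q (u, [::]) I QS.
have [z zP] : exists z, forall n, follows (f n).1 z.
  by apply: (follows_chain false) => n; have [_ []] := fP n.
have [r rP] : exists r, forall n, follows (f n).2 r.
  by apply: (follows_chain false) => n; have [_ []] := fP n.
pose x b i := if i < k then digits k i else if i == k then b else r (i - k.+1).
have xk b : agree k (x b) (digits k) by move=> i lti; rewrite /x lti.
have xP b t : follows t r -> follows (w b t) (x b).
  move=> tr; apply/follows_cat; rewrite size_mkseq; split.
    apply: (@nth_follows _ _ _ false) => i; rewrite size_mkseq => lti.
    by rewrite nth_mkseq // xk.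
  apply: (@nth_follows _ _ _ false) => -[_|i lti] /=.
    by rewrite /x addn0 ltnn eqxx.
  rewrite /x ltnNge leq_addr /= -[X in _ == X]addn0 eqn_add2l /= addnS subSS.
  by rewrite addKn (follows_nth false tr).
have vx b : follows v (x b).
  apply: (@nth_follows _ _ _ false) => i lti.
  by rewrite xk ?kv // (ltn_trans lti).
have uz : follows u z by have := zP 0; rewrite f0.
have nE b : ~ E z (x b).
  move=> Ezx; apply: (DE z (x b)) => // n.
  have [_ [_ _ D0 D1]] := fP n.
  have [a1 [t1 [Da /follows_prefix az /follows_prefix tr]]] :
      exists a1 t1,
      [/\ D n a1 (w b t1), prefix a1 (f n.+1).1 & prefix t1 (f n.+1).2].
    by case: b {Ezx}.
  exists a1, (w b t1); split=> //; first exact: az.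
  exact/xP/tr.
suff /edgeE-/(_ z)[] : G0_edge k (x false) (x true) by exact: nE.
split=> //; rewrite /x ?ltnn ?eqxx // => i ltki.
by rewrite ltnNge (ltnW ltki) gtn_eqF.
Qed.

End category.

(** * Fusion *)

Section fusion.
Context (A : (nat -> bool) -> (nat -> bool) -> (nat -> nat) -> Prop).
Implicit Types (u v : seq bool) (w : seq nat).

Let A_ w x y := exists2 c, follows w c & A x y c.

(** Nonmeagerness is required in every subbox, so that it survives later lengthening of [u] and
    [v]. *)
Definition large u v w := forall s t, ~ meager2 (fun x y =>
  [/\ follows (u ++ s) x, follows (v ++ t) y & A_ w x y]).

Lemma large_prefix u v u' v' w :
  prefix u u' -> prefix v v' -> large u v w -> large u' v' w.
Proof.
by move=> /prefixP[s ->] /prefixP[t ->] l s' t'; rewrite -!catA; exact: l.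
Qed.

Lemma large_witness u v w : large u v w ->
  exists x y c, [/\ follows u x, follows v y, follows w c & A x y c].
Proof.
move=> /(_ [::] [::]); rewrite !cats0 => nm; apply: contrapT => nex; apply: nm.
apply: meager2_set0 => x y [ux vy [c wc Axyc]].
by apply: nex; exists x, y, c.
Qed.

(** The next value [k] of the witness splits the projection into countably many pieces. If none were
    large in a subbox, each would be meager by [meager2_local], and so would their union. *)
Lemma large_rcons u v w : large u v w ->
  exists s t k, large (u ++ s) (v ++ t) (rcons w k).
Proof.
move=> l; apply: contrapT => nex; apply: (l [::] [::]); rewrite !cats0.
have mk : meager2 (fun x y => exists k,
    [/\ follows u x, follows v y & A_ (rcons w k) x y]).
  apply: meager2_bigcup => k; apply: meager2_local => s t.
  apply: contrapT => nm; apply: nex; exists s, t, k => s' t'.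
  by rewrite -!catA => m; apply: nm; exists s', t'.
apply: meager2_sub mk => x y [ux vy [c wc Axyc]]; exists (c (size w)).
split=> //; exists c => //; rewrite -cats1; apply/follows_cat; split=> //.
by rewrite /follows /mkseq /= addn0.
Qed.

(* [st.1 s] is the condition assigned to the node [s] of the fusion tree, and
   [st.2 s t] the initial segment of a witness for the pair of nodes [(s, t)]. *)
Definition state :=
  ((seq bool -> seq bool) * (seq bool -> seq bool -> seq nat))%type.
Implicit Types st : state.

Definition large_state st :=
  forall s t, s != t -> large (st.1 s) (st.1 t) (st.2 s t).

Definition refines st' st :=
  (forall s, prefix (st.1 s) (st'.1 s)) /\
  forall s t, prefix (st.2 s t) (st'.2 s t).

Lemma refines_trans st1 st2 st3 :
  refines st1 st2 -> refines st2 st3 -> refines st1 st3.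
Proof.
move=> [u12 w12] [u23 w23]; split=> [s|s t].
  exact: prefix_trans (u23 s) (u12 s).
exact: prefix_trans (w23 s t) (w12 s t).
Qed.

(** Only the conditions of [s] and [t] are lengthened; the other pairs stay large by
    [large_prefix]. *)
Lemma lengthen_witness st s t : large_state st -> s != t ->
  exists st', [/\ large_state st', refines st' st
    & size (st.2 s t) < size (st'.2 s t)].
Proof.
case: st => u w lst nst; have /= [a [b [k lk]]] := large_rcons (lst s t nst).
pose u' r := if r == s then u s ++ a else if r == t then u t ++ b else u r.
pose w' r r' := if (r == s) && (r' == t) then rcons (w s t) k else w r r'.
have uu' r : prefix (u r) (u' r).
  rewrite /u'; case: eqP => [->|_]; first exact: prefix_prefix.
  by case: eqP => [->|_]; [exact: prefix_prefix | exact: prefix_refl].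
exists (u', w'); split=> /=.
- move=> r r' nrr' /=; rewrite /w'; case: andP => [[/eqP rs /eqP r't]|_].
    by rewrite rs r't /u' eqxx eq_sym (negbTE nst) eqxx.
  exact: large_prefix (uu' r) (uu' r') (lst _ _ nrr').
- split=> //= r r'; rewrite /w'; case: andP => [[/eqP-> /eqP->]|_].
    by rewrite -cats1 prefix_prefix.
  exact: prefix_refl.
- by rewrite /w' !eqxx /= size_rcons.
Qed.

Lemma lengthen_witnesses (l : seq (seq bool * seq bool)) st : large_state st ->
  exists st', [/\ large_state st', refines st' st
    & forall s t, (s, t) \in l -> s != t ->
        size (st.2 s t) < size (st'.2 s t)].
Proof.
move=> lst; elim: l => [|[s t] l [st1 [lst1 st10 lt1]]].
  by exists st; split=> //; split=> *; exact: prefix_refl.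
have [<-|nst] := eqVneq s t.
  exists st1; split=> // s' t'; rewrite inE => /orP[/eqP[-> ->]|].
    by rewrite eqxx.
  exact: lt1.
have [st2 [lst2 st21 lt2]] := lengthen_witness lst1 nst.
exists st2; split=> //; first exact: refines_trans st21 st10.
move=> s' t'; rewrite inE => /orP[/eqP[-> ->] _|/lt1 lt' /lt' {}lt'].
  by apply: leq_ltn_trans lt2; apply: size_prefix; case: st10.
by apply: leq_trans lt' _; apply: size_prefix; case: st21.
Qed.

(** Both children inherit the condition of their parent. The added [false] is an arbitrary bit that
    forces the lengths to infinity; siblings restart with the empty witness. *)
Definition split_state st : state :=
  (fun s => rcons (st.1 (behead s)) false,
   fun s t => if behead s == behead t then [::]
              else st.2 (behead s) (behead t)).

Lemma large_split st : (forall u v, large u v [::]) ->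
  large_state st -> large_state (split_state st).
Proof.
move=> l0 lst s t nst /=; case: eqP => [_|/eqP nbst]; first exact: l0.
by apply: large_prefix (lst _ _ nbst); rewrite -cats1 prefix_prefix.
Qed.

Lemma perfect_fusion : closed3 A ->
  (forall u v, ~ meager2 (fun x y =>
    [/\ follows u x, follows v y & exists c, A x y c])) ->
  exists q : (nat -> bool) -> nat -> bool,
    (forall x y i, (forall j, j <= i -> x j = y j) -> q x i = q y i) /\
    forall x y, x <> y -> exists c, A (q x) (q y) c.
Proof.
move=> clA nmA.
have l0 u v : large u v [::].
  move=> s t m; apply: (nmA (u ++ s) (v ++ t)).
  by apply: meager2_sub m => x y [? ? [c ?]]; split=> //; exists c.
pose all_pairs n := [seq (s, t) | s <- words n, t <- words n].
pose Q n st st' := refines st' (split_state st) /\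
  forall s t, (s, t) \in all_pairs n.+1 -> s != t ->
  size ((split_state st).2 s t) < size (st'.2 s t).
have QS n st : large_state st -> exists st', large_state st' /\ Q n st st'.
  move=> /(large_split l0) /(lengthen_witnesses (all_pairs n.+1)).
  by case=> st' [? ? ?]; exists st'; split.
have lst0 : large_state (fun=> [::], fun _ _ => [::]).
  by move=> s t _; apply: l0.
have [f [_ fP]] := stepwise_choice lst0 QS.
have uS x n : prefix (rcons ((f n).1 (rev_prefix x n)) false)
    ((f n.+1).1 (rev_prefix x n.+1)).
  by have [_ [[+ _] _]] := fP n => /(_ (rev_prefix x n.+1)).
have su x n : n <= size ((f n).1 (rev_prefix x n)).
  elim: n => // n IHn; apply: leq_trans (size_prefix (uS x n)).
  by rewrite size_rcons.
have /choice[q qP] x : exists q, forall n, follows ((f n).1 (rev_prefix x n)) q.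
  apply: (follows_chain false) => n; apply: prefix_trans (uS x n).
  by rewrite -cats1 prefix_prefix.
exists q; split=> [x y i xy|x y nxy].
  apply: (@follows_agree _ ((f i.+1).1 (rev_prefix x i.+1))) => //.
  by rewrite (@eq_rev_prefix x y).
have [k xyk] : exists k, x k <> y k.
  by apply: contrapT => nex; apply: nxy; apply/funext => k;
    apply: contrapT => ?; apply: nex; exists k.
(* From level [k.+1] on the nodes of [x] and [y] differ, so their witness is inherited and
   lengthened at every further step. *)
have nxyk m : rev_prefix x (k.+1 + m) != rev_prefix y (k.+1 + m).
  apply/eqP; rewrite !rev_prefixD => /eqP.
  by rewrite eqseq_cat ?size_rev_prefix //= eqseq_cons => /and3P[_ /eqP].
pose w m :=
  (f (k.+1 + m)).2 (rev_prefix x (k.+1 + m)) (rev_prefix y (k.+1 + m)).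
have wS m : prefix (w m) (w m.+1) /\ size (w m) < size (w m.+1).
  rewrite /w addnS; have [_ [[_ pw] sw]] := fP (k.+1 + m).
  set rx := rev_prefix x (k.+1 + m).+1; set ry := rev_prefix y (k.+1 + m).+1.
  have nb : (behead rx == behead ry) = false by apply: negbTE; exact: nxyk.
  have := pw rx ry; have := sw rx ry; rewrite /= nb => {}sw {}pw; split=> //.
  apply: sw; last by apply: contraFneq nb => ->.
  by apply/allpairsP; exists (rx, ry); rewrite !mem_words // size_rev_prefix.
have sw m : m <= size (w m).
  by elim: m => // m IHm; apply: leq_ltn_trans IHm (proj2 (wS m)).
have [c cP] : exists c, forall m, follows (w m) c.
  by apply: (follows_chain 0) => m; have [] := wS m.
(* Largeness at each level yields a triple in [A] through the current conditions; closedness passes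
   to the limit. *)
exists c; apply: clA => m.
have [lst _] := fP (k.+1 + m).
have [x' [y' [c' [ux uy wc Ac]]]] := large_witness (lst _ _ (nxyk m)).
have ltu z : m <= size ((f (k.+1 + m)).1 (rev_prefix z (k.+1 + m))).
  by apply: leq_trans (su z _); exact: leq_addl.
exists x', y', c'; split=> // i lti.
- exact: follows_agree ux (qP x _) (leq_trans lti (ltu x)).
- exact: follows_agree uy (qP y _) (leq_trans lti (ltu y)).
- exact: follows_agree wc (cP m) (leq_trans lti (sw m)).
Qed.

End fusion.

(** [K] will stand for [delta <= d] and [L] for [delta / 2 <= d], both with witnesses; the
    hypothesis linking them is the trace of the triangle inequality. *)
Lemma perfect_clique
    (K L : (nat -> nat) -> (nat -> nat) -> (nat -> nat) -> Prop) :
  closed3 K -> closed3 L ->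
  (forall a b c w, K a b w -> exists w', L c a w' \/ L c b w') ->
  ~ countably_colorable (fun a b => exists c, K a b c) setT ->
  exists h : (nat -> bool) -> nat -> nat,
    (forall x y i, (forall j, j <= i -> x j = y j) -> h x i = h y i) /\
    forall x y, x <> y -> exists c, L (h x) (h y) c.
Proof.
move=> clK clL KL nc.
have [p [pE pG]] := G0_homomorphism clK nc.
pose A x y c := L (p x) (p y) c.
have clA : closed3 A.
  move=> x y c clxyc; apply: clL => n.
  have [x' [y' [c' [Ac xx yy cc]]]] := clxyc n.
  exists (p x'), (p y'), c'; split=> // i lti; apply: pE => j leji.
    exact: xx (leq_ltn_trans leji lti).
  exact: yy (leq_ltn_trans leji lti).
have edgeA k x y z : G0_edge k x y ->
    (exists c, A z x c) \/ (exists c, A z y c).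
  by move=> /pG[w /(KL _ _ (p z))[w' [?|?]]]; [left | right]; exists w'.
have [q [qE qA]] := perfect_fusion clA (G0_nonmeager2 edgeA).
exists (p \o q); split=> // x y i xy /=; apply: pE => j leji.
apply: qE => l lelj; exact/xy/(leq_trans lelj).
Qed.

(** * Topology *)

Section baire_space.
Implicit Types (a b : {ptws nat -> nat}) (x y : {ptws nat -> bool}).

Lemma agree_cvg (b : nat -> {ptws nat -> nat}) a :
  (forall n, agree n (b n) a) -> b @ \oo --> a.
Proof.
move=> ba; apply/pointwise_cvgP => i; apply: cvg_near_cst.
by exists i.+1 => // n /= ltin; exact: ba.
Qed.

Lemma nbhs_agree a (U : set {ptws nat -> nat}) : nbhs a U ->
  exists n, forall b, agree n b a -> U b.
Proof.
move=> aU; apply: contrapT => nU.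
have /choice[b bP] n : exists b, agree n b a /\ ~ U b.
  apply: contrapT => nb; apply: nU; exists n => b ba.
  by apply: contrapT => nUb; apply: nb; exists b.
have [|N _ /(_ N) /= UN] := @agree_cvg b a _ U aU.
  by move=> n; case: (bP n).
by have [_] := bP N; apply; exact: UN.
Qed.

Lemma nbhs_prefix x n : nbhs x [set y | agree n y x].
Proof.
have Fx := nbhs_filter x.
elim: n => [|n IHn]; first by apply: filterE => y i.
have yn : nbhs x [set y : {ptws nat -> bool} | y n = x n].
  exact: (@proj_continuous _ (fun _ : nat => bool) n x _ (discrete_set1 (x n))).
apply: filterS2 IHn yn => y yx yn i; rewrite ltnS leq_eqVlt => /orP[/eqP->//|].
exact: yx.
Qed.

Lemma local_continuous (h : {ptws nat -> bool} -> {ptws nat -> nat}) :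
  (forall x y i, (forall j, j <= i -> x j = y j) -> h x i = h y i) ->
  continuous h.
Proof.
move=> hE x; apply/pointwise_cvgP => i; apply: cvg_near_cst.
have Fx := nbhs_filter x; apply: filterS (nbhs_prefix x i.+1) => y yx.
apply: hE => j leji; exact: yx.
Qed.

(** Keeping the witness [c] turns an analytic relation into a closed one, because limits in [X] are
    unique. *)
Lemma closed3_graph (X : topologicalType) (f : {ptws nat -> nat} -> X)
    (g : {ptws nat -> nat} -> X * X) :
  hausdorff_space X -> continuous f -> continuous g ->
  closed3 (fun a b c : {ptws nat -> nat} => g c = (f a, f b)).
Proof.
move=> hX cf cg a b c /choice[a' /choice[b' /choice[c' abc]]].
have a'a : a' @ \oo --> (a : {ptws nat -> nat}).
  by apply: agree_cvg => n; have [] := abc n.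
have b'b : b' @ \oo --> (b : {ptws nat -> nat}).
  by apply: agree_cvg => n; have [] := abc n.
have c'c : c' @ \oo --> (c : {ptws nat -> nat}).
  by apply: agree_cvg => n; have [] := abc n.
have gc' : g \o c' @ \oo --> g c by apply: cvg_comp c'c _; exact: cg.
have fa' : f \o a' @ \oo --> f a by apply: cvg_comp a'a _; exact: cf.
have fb' : f \o b' @ \oo --> f b by apply: cvg_comp b'b _; exact: cf.
have gfst : fst \o (g \o c') = f \o a'.
  by apply/funext => n /=; have [->] := abc n.
have gsnd : snd \o (g \o c') = f \o b'.
  by apply/funext => n /=; have [->] := abc n.
rewrite [g c]surjective_pairing; congr pair.
  apply: (@cvg_unique _ hX (f \o a' @ \oo)) => //; rewrite -gfst.
  by apply: cvg_comp gc' _; exact: cvg_fst.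
apply: (@cvg_unique _ hX (f \o b' @ \oo)) => //; rewrite -gsnd.
by apply: cvg_comp gc' _; exact: cvg_snd.
Qed.

Lemma ptws_bool_compact : compact [set: {ptws nat -> bool}].
Proof.
have := @tychonoff _ (fun _ : nat => bool) _ (fun=> bool_compact).
by congr (compact _); apply/seteqP.
Qed.

(** A compact image is closed in a Hausdorff space; flipping one far bit gives nearby points,
    distinct by injectivity. *)
Lemma perfect_range (X : topologicalType) (f : {ptws nat -> nat} -> X)
    (h : {ptws nat -> bool} -> {ptws nat -> nat}) :
  hausdorff_space X -> continuous f -> injective (f \o h) ->
  (forall x y i, (forall j, j <= i -> x j = y j) -> h x i = h y i) ->
  perfect_set (range (f \o h)).
Proof.
move=> hX cf fh_inj hE.
have cfh : continuous (f \o h).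
  by move=> x; apply: continuous_comp; [exact: local_continuous | exact: cf].
have closed_fh : closed (range (f \o h)).
  apply: compact_closed hX _; apply: continuous_compact ptws_bool_compact.
  by apply: continuous_subspaceT.
split=> //; apply/seteqP; split=> [z|_ [x _ <-] U fhxU].
  by move=> /subset_limit_point; rewrite -(closure_id _).1.
have [n nU] : exists n, forall y, agree n y x -> U (f (h y)).
  have [n nU] := nbhs_agree (cf _ _ fhxU).
  exists n => y yx; apply: nU => i lti; apply: hE => j leji.
  exact: yx (leq_ltn_trans leji lti).
pose y i := if i == n then ~~ x n else x i.
exists (f (h y)); split.
- apply/eqP => /fh_inj /(congr1 (fun z => z n)); rewrite /y eqxx.
  by case: (x n).
- by exists y.
- by apply: nU => i lti; rewrite /y ltn_eqF.
Qed.

End baire_space.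

(** * Pseudo-metrics: small countable covers or perfect sets *)

Local Open Scope ring_scope.

Lemma metrizable_hausdorff (R : realType) (X : topologicalType)
    (rho : X -> X -> R) :
  is_metric rho -> metric_induces_topology rho -> hausdorff_space X.
Proof.
move=> [[ge0 _ sym tri] sep] top x y clxy.
apply: sep; apply: contrapT => /eqP nxy.
have gt0 : 0 < rho x y / 2 by rewrite divr_gt0 // lt_neqAle eq_sym nxy ge0.
have nb z : nbhs z [set w | rho z w < rho x y / 2].
  by apply/top; exists (rho x y / 2).
have [z [/= xz yz]] := clxy _ _ (nb x) (nb y).
have := le_lt_trans (tri x z y) (ltrD xz _); rewrite (sym z y) => /(_ _ yz).
by rewrite -splitr ltxx.
Qed.

(** A countable coloring of the graph [delta <= d] yields the cover; without one, [perfect_clique]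
    gives the perfect set, and the triangle inequality costs the factor 2. *)
Lemma small_cover_or_perfect (R : realType) (X : topologicalType)
    (d : X -> X -> R) (delta : R) :
  hausdorff_space X -> is_pseudometric d ->
  (forall e, 0 < e -> coanalytic_set [set uv : X * X | d uv.1 uv.2 < e]) ->
  0 < delta ->
  (exists2 B : nat -> set X, \bigcup_i B i = setT
     & forall i u v, B i u -> B i v -> d u v < delta) \/
  exists C : set X, [/\ perfect_set C, C !=set0
    & forall u v, C u -> C v -> u <> v -> delta / 2 <= d u v].
Proof.
move=> hX [_ d0 sym tri] coan delta_gt0.
have delta2_gt0 : 0 < delta / 2 by rewrite divr_gt0.
have [far0|[g cg grange]] := coan _ delta_gt0.
  left; exists (fun=> setT); first by apply/seteqP; split=> // u _; exists 0.
  move=> _ u v _ _; apply: contrapT => nuv.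
  suff : (@set0 (X * X)) (u, v) by [].
  by rewrite -far0.
have gP u v : (exists c, g c = (u, v)) <-> ~ d u v < delta.
  suff <- : range g (u, v) = (~ d u v < delta).
    by split=> [[c ?]|[c _ ?]]; exists c.
  by rewrite grange.
(* Points outside the range of [f] have no neighbor in the graph [delta <= d],
   so they form one independent set and [f] can replace a continuous surjection
   of the Baire space onto [X]. *)
pose f := fst \o g.
have cf : continuous f.
  by move=> c; apply: continuous_comp; [exact: cg | exact: cvg_fst].
have [[B Bind BT]|nc] :=
    pselect (countably_colorable (fun a b => exists c, g c = (f a, f b)) setT).
  left; exists (fun i => if i is j.+1 then f @` B j else ~` range f).
    apply/seteqP; split=> // u _; have [[a _ <-]|nfu] := pselect (range f u).
      by have [i _ Ba] := BT a I; exists i.+1 => //; exists a.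
    by exists 0.
  move=> [|i] u v /=; last first.
    move=> [a Ba <-] [b Bb <-]; apply: contrapT => /gP.
    exact: (Bind i a b).
  move=> nfu _; apply: contrapT => /gP[c gc]; apply: nfu.
  by exists c => //; rewrite /f /= gc.
right.
(* The complement at [delta / 2] cannot be empty: the pair [g point] has distance at least
   [delta]. *)
have [far0|[g' cg' g'range]] := coan _ delta2_gt0.
  have /gP nlt : exists c, g c = ((g point).1, (g point).2).
    by exists point; exact: surjective_pairing.
  suff : (@set0 (X * X)) (g point) by [].
  rewrite -far0 /= => lt; apply: nlt; apply: lt_le_trans lt _.
  by rewrite [leRHS]splitr lerDl ltW.
have g'P u v : (exists c, g' c = (u, v)) <-> ~ d u v < delta / 2.
  suff <- : range g' (u, v) = (~ d u v < delta / 2).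
    by split=> [[c ?]|[c _ ?]]; exists c.
  by rewrite g'range.
have [] :=
  perfect_clique (closed3_graph hX cf cg) (closed3_graph hX cf cg') _ nc.
  move=> a b c w gw; have /gP nlt : exists c, g c = (f a, f b) by exists w.
  have [ca|/g'P[w' ?]] := pselect (d (f c) (f a) < delta / 2); last first.
    by exists w'; left.
  have [cb|/g'P[w' ?]] := pselect (d (f c) (f b) < delta / 2); last first.
    by exists w'; right.
  case: nlt; apply: le_lt_trans (tri _ (f c) _) _.
  by rewrite [delta]splitr ltrD // sym.
move=> h [hE hP].
have far x y : x <> y -> delta / 2 <= d (f (h x)) (f (h y)).
  by move=> /hP/g'P/negP; rewrite -leNgt.
exists (range (f \o h)); split.
(* Equal images have distance 0, below [delta / 2], which gives injectivity. *)
- apply: perfect_range => // x y fhxy; apply: contrapT => /far.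
  by move: fhxy => /= ->; rewrite d0 leNgt delta2_gt0.
- by exists (f (h point)), point.
- move=> _ _ [x _ <-] [y _ <-] nfh; apply: far => xy; apply: nfh.
  by rewrite xy.
Qed.

(** If there is no perfect set as required, every scale [1/(n+1)] admits a countable cover by small
    pieces; one point from each nonempty piece gives a countable dense set. *)
Theorem theorem1p2 (R : realType) (X : topologicalType)
    (HX : polish_space R X) (d : X -> X -> R) (Hd : is_pseudometric d)
    (Hcoanalytic : forall delta : R, 0 < delta ->
       coanalytic_set [set uv : X * X | d uv.1 uv.2 < delta]) :
  separable_pseudometric d \/
  exists2 delta : R, 0 < delta &
    exists C : set X,
      [/\ perfect_set C, C !=set0
        & forall u v : X, C u -> C v -> u <> v -> delta <= d u v].
Proof.
have [_ [rho [mrho topX _]]] := HX.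
have hX := metrizable_hausdorff mrho topX.
case: (pselect (exists2 delta : R, 0 < delta & exists C : set X,
    [/\ perfect_set C, C !=set0
      & forall u v : X, C u -> C v -> u <> v -> delta <= d u v])) => [|nperf].
  by right.
left.
have /choice[B BP] (n : nat) : exists B : nat -> set X,
    \bigcup_i B i = setT /\ forall i u v, B i u -> B i v -> d u v < n.+1%:R^-1.
  have n_gt0 : 0 < n.+1%:R^-1 :> R by rewrite invr_gt0 ltr0n.
  have [[B BT Bd]|perf] := small_cover_or_perfect hX Hd Hcoanalytic n_gt0.
    by exists B.
  by case: nperf; exists (n.+1%:R^-1 / 2) => //; rewrite divr_gt0.
(* The point [x0] is the default choice for empty pieces, so an empty [X] is treated apart. *)
have [[x0 _]|X0] := pselect (exists x : X, True); last first.
  by exists set0 => // u; case: X0; exists u.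
have /choice[s sP] (ni : nat * nat) :
    exists s, forall u, B ni.1 ni.2 u -> B ni.1 ni.2 s.
  have [[u Bu]|B0] := pselect (exists u, B ni.1 ni.2 u); first by exists u.
  by exists x0 => u Bu; case: B0; exists u.
exists (range s); first exact: sub_countable (card_image_le _ _) (countableP _).
move=> u e e_gt0; have [n ne] : exists n, n.+1%:R^-1 < e.
  exists (Num.truncn e^-1); rewrite invf_plt ?posrE ?ltr0n //.
  exact: truncnS_gt.
have [BT Bd] := BP n; have [i _ Bu] : (\bigcup_i B n i) u by rewrite BT.
exists (s (n, i)); first by exists (n, i).
exact: lt_trans (Bd _ _ _ Bu (sP (n, i) _ Bu)) ne.
Qed.
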